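(* For every natural number $t\ge 2$ and every odd natural number $g$ with $3\le g\le t$, there exists a finite simple graph $G$ with edge connectivity $t$ that has a guarding set of size $g$.
   Context: The edge connectivity of a graph is the minimum number of edges whose removal disconnects it. An acyclic orientation of a graph $G=(V,E)$ is an orientation of each edge such that the resulting directed graph has no directed cycle. An edge $e$ is flippable in an acyclic orientation if reversing the orientation of $e$ alone yields again an acyclic orientation. A subset $S\subseteq E$ is a guarding set for $G$ if for every acyclic orientation of $G$ there exists an edge $e\in S$ that is flippable in that orientation. *)

(* Defs.v *)
From mathcomp Require Import all_boot.
Set Implicit Arguments.
Unset Strict Implicit.
Unset Printing Implicit Defensive.

Record sgraph := SGraph {
  vertex :> finType;
  adj : rel vertex;
  adj_sym : symmetric adj;
  adj_irr : irreflexive adj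
}.

Section Graph.
Variable G : sgraph.
Implicit Types (o : rel G) (f : {set G}) (F S : {set {set G}}).

Definition edges : {set {set G}} := [set [set x; y] | x in G, y in G & adj x y].

Definition remove_edges F : rel G :=
  [rel x y | adj x y && ([set x; y] \notin F)].

Definition disconnecting F : Prop :=
  F \subset edges /\ exists x y : G, ~~ connect (remove_edges F) x y.

(* The one-vertex graph has no disconnecting edge set, hence no edge
   connectivity in this sense. *)
Definition has_edge_connectivity (t : nat) : Prop :=
  (exists2 F, disconnecting F & #|F| = t) /\
  (forall F, disconnecting F -> t <= #|F|).

(* o x y means that the edge {x, y} is directed from x to y. *)
Definition orientation o : Prop :=
  (forall x y, o x y -> adj x y) /\ (forall x y, adj x y -> o x y (+) o y x).

Definition acyclic o : Prop := forall c : seq G, ucycle o c -> c = [::].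

Definition acyclic_orientation o : Prop := orientation o /\ acyclic o.

Definition reverse_edge o f : rel G :=
  [rel x y | if [set x; y] == f then o y x else o x y].

Definition flippable o f : Prop := acyclic_orientation (reverse_edge o f).

Definition guarding_set S : Prop :=
  S \subset edges /\
  (forall o, acyclic_orientation o -> exists2 f, f \in S & flippable o f).

End Graph.

(* Main.v *)
Require Import Defs.
From mathcomp Require Import all_boot.
From mathcomp Require Import zify.

Set Implicit Arguments.
Unset Strict Implicit.
Unset Printing Implicit Defensive.

(** Glue [g] cliques of size [t + 1] along one common vertex [v], pick a vertex
    [c i <> v] in each of them, and join the [c i] by a cycle of length [g].  The
    edge connectivity is that of a single clique, namely [t].  The [g] cycle
    edges are guarding: since [g] is odd, some of them are monochromatic for the
    colouring "[v] is reachable from [c i]".  Take a monochromatic edge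
    [x -> y] with [y] as low as possible.  A second directed path from [x] to
    [y] cannot pass through [v], hence cannot enter the clique of [x], so it
    starts with a monochromatic cycle edge [x -> z] with [z] below [y]; this
    contradicts minimality, so [x -> y] is flippable. *)

(** * Unordered pairs, the cyclic successor and odd cycles *)

Lemma set2_eqP (T : finType) (a b x y : T) :
  [set a; b] = [set x; y] -> (a = x /\ b = y) \/ (a = y /\ b = x).
Proof.
move=> E.
have := set21 a b; have := set22 a b; rewrite E !inE.
have := set21 x y; have := set22 x y; rewrite -E !inE.
by do 4![case/orP=> /eqP ?]; subst; auto.
Qed.

Lemma val_ordS n (i : 'I_n) :
  ordS i = (if i.+1 == n then 0 else i.+1) :> nat.
Proof.
rewrite /=; case: eqP => [->|ne]; first by rewrite modnn.
by rewrite modn_small //; have := ltn_ord i; lia.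
Qed.

(** If neighbours always differed, [b] would alternate along the indices from [0]; as [n] is odd,
    the last index would then agree with its successor [0]. *)
Lemma odd_cycle_monochromatic n (b : 'I_n -> bool) :
  odd n -> exists i, b i = b (ordS i).
Proof.
case: n b => // n b on.
case: (boolP [exists i, b i == b (ordS i)]) => [/existsP [i /eqP] | H].
  by exists i.
have alt k : k <= n -> b (inord k) = odd k (+) b ord0.
  elim: k => [|k IH] lk; first by congr b; apply/val_inj; rewrite /= inordK.
  have -> : inord k.+1 = ordS (inord k : 'I_n.+1).
    apply: ord_inj; rewrite val_ordS !inordK ?ltnS ?(ltnW lk) //.
    by case: eqP => //; lia.
  move: H; rewrite negb_exists => /forallP /(_ (inord k)).
  rewrite (IH (ltnW lk)) oddS.
  by case: (b (ordS (inord k))); case: (odd k); case: (b ord0).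
move: H; rewrite negb_exists => /forallP /(_ ord_max).
have -> : ordS (ord_max : 'I_n.+1) = ord0.
  by apply: ord_inj; rewrite val_ordS /= eqxx.
have -> : ord_max = inord n :> 'I_n.+1 by apply/val_inj; rewrite /= inordK.
by rewrite alt //; move: on => /= /negbTE ->; rewrite addFb eqxx.
Qed.

(** * Acyclic orientations and flippable edges *)

Section Acyclic.
Variable G : sgraph.
Implicit Types o : rel G.

Lemma acyclic_no_return o x y : acyclic o -> o x y -> ~~ connect o y x.
Proof.
move=> ao oxy; apply/negP => /connectP [p pp Ex].
case/shortenP: pp Ex => q pq uq _ Ex.
suff : ucycle o (y :: q) by move/ao.
by rewrite /ucycle /ucycleb uq andbT /= rcons_path pq -Ex.
Qed.

Lemma no_return_acyclic o :
  (forall x y, o x y -> ~~ connect o y x) -> acyclic o.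
Proof.
move=> H [|x [|y p]] // /andP [] /=.
  by rewrite andbT => /H; rewrite connect0.
case/andP=> /H /negP nc pp _; case: nc.
by apply/connectP; exists (rcons p x); rewrite ?last_rcons.
Qed.

Lemma acyclic_connect_anti o x y :
  acyclic o -> connect o x y -> connect o y x -> x = y.
Proof.
move=> ao /connectP [[|z p] /=]; first by move=> _ ->.
case/andP=> oxz pp Ey cyx.
case/negP: (acyclic_no_return ao oxz).
by apply: connect_trans cyx; apply/connectP; exists p.
Qed.

(** A directed cycle created by the reversal uses [y -> x], so it closes up a second path from [x]
    to [y]; the last hypothesis rules out the first step of such a path. *)
Lemma flippable_of_no_detour o x y :
  acyclic_orientation o -> o x y ->
  (forall z, o x z -> z != y -> ~~ connect o z y) ->
  flippable o [set x; y].
Proof.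
move=> [[oa ox] ao] oxy nd.
pose o' : rel G := [rel a b | o a b && ((a, b) != (x, y))].
have o'o a b : connect o' a b -> connect o a b.
  by apply: connect_sub => u w /andP [ouw _]; apply: connect1.
have nyx : ~~ o y x.
  by have := ox _ _ (oa _ _ oxy); rewrite oxy.
have rE a b : reverse_edge o [set x; y] a b ->
    o' a b \/ (a = y /\ b = x).
  rewrite /reverse_edge /=; case: eqP => [/set2_eqP|ne oab].
    case=> [[-> ->]|[-> ->]] //; last by right.
    by rewrite (negbTE nyx).
  left; rewrite /o' /= oab; apply/eqP => -[Ea Eb].
  by apply: ne; rewrite Ea Eb.
have nxy : ~~ connect o' x y.
  apply/negP => /connectP [[|z p] /=].
    by move=> _ E; move: nyx; rewrite -E in oxy *; rewrite oxy.
  case/andP=> /andP [oxz ne] pp Ey.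
  have zy : z != y by apply: contraNneq ne => ->.
  case/negP: (nd z oxz zy); apply: o'o.
  by apply/connectP; exists p.
(* Cutting a walk at its first and last use of [y -> x] leaves walks in [o'] that end at [y] and
   start at [x]. *)
have split_path a b : connect (reverse_edge o [set x; y]) a b ->
    connect o' a b \/ (connect o' a y /\ connect o' x b).
  case/connectP=> p; elim: p a => [|c p IH] a /=.
    by move=> _ ->; left; apply: connect0.
  case/andP=> /rE rac /IH IHc /IHc {IH IHc} H.
  case: rac H => [oac|[-> ->]].
    have cac := connect1 oac.
    by case=> [ccb|[ccy cxb]]; [left|right; split=> //];
       apply: connect_trans cac _.
  by case=> [cxb|[_ cxb]]; right; split=> //; apply: connect0.
split; first split=> [a b|a b ab].
- rewrite /reverse_edge /=; case: ifP => _ oab; last exact: oa.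
  by rewrite adj_sym; apply: oa.
- rewrite /reverse_edge /= [[set b; a]]setUC; case: ifP => _; last exact: ox.
  by rewrite addbC; apply: ox.
apply: no_return_acyclic => a b rab; apply/negP => /split_path.
case: (rE _ _ rab) => [oab|[-> ->]] [cba|[cby cxa]].
- by case/andP: oab => oab _; case/negP: (acyclic_no_return ao oab); apply: o'o.
- case/negP: nxy; apply: connect_trans cxa _.
  exact: connect_trans (connect1 oab) cby.
- by rewrite cba in nxy.
- by rewrite cby in nxy.
Qed.

End Acyclic.

(** * The graph: cliques glued at a hub, with a rim cycle *)

Section CliqueFlower.
Variables g t : nat.

(** The conjunct [i != k] removes the loop that [ordS] gives when [g = 1]. *)
Definition cyclic_adj (i k : 'I_g) : bool :=
  (i != k) && ((ordS i == k) || (ordS k == i)).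

(* [None] is the common vertex, [Some (i, j)] with [j : 'I_t.+1] are the other
   vertices of the [i]-th clique (which is a K_{t+2}), and the cycle runs through
   the [Some (i, ord0)]. *)
Definition flower_adj (x y : option ('I_g * 'I_t.+1)) : bool :=
  match x, y with
  | None, None => false
  | Some (i, j), Some (k, l) =>
      ((i == k) && (j != l)) || [&& j == ord0, l == ord0 & cyclic_adj i k]
  | _, _ => true
  end.

Lemma cyclic_adjC : symmetric cyclic_adj.
Proof. by move=> i k; rewrite /cyclic_adj eq_sym orbC. Qed.

Lemma flower_adj_sym : symmetric flower_adj.
Proof.
move=> [[i j]|] [[k l]|] //=.
by rewrite cyclic_adjC [i == k]eq_sym [j == l]eq_sym andbCA.
Qed.

Lemma flower_adj_irr : irreflexive flower_adj.
Proof.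
by move=> [[i j]|] //=; rewrite /cyclic_adj !eqxx /= !andbF.
Qed.

Definition flower : sgraph := SGraph flower_adj_sym flower_adj_irr.

Definition hub : flower := None.
Definition petal (i : 'I_g) (j : 'I_t.+1) : flower := Some (i, j).

(** * Edge connectivity of the flower *)

Lemma remove_edges_sym (F : {set {set flower}}) : symmetric (remove_edges F).
Proof.
by move=> x y; rewrite /remove_edges /= flower_adj_sym setUC.
Qed.

(* In a clique, [u] and [v] are joined by the edge [uv] and by the paths [u w v];
   these are edge-disjoint, so each contributes its own element of a separating [F]. *)
Lemma petal_connect_hub (F : {set {set flower}}) i j :
  #|F| <= t -> connect (remove_edges F) (petal i j) hub.
Proof.
move=> cF; apply: contraLR (cF) => nc; rewrite -ltnNge.
pose e (k : 'I_t.+1) : {set flower} :=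
  if (k != j) && ([set petal i j; petal i k] \in F)
  then [set petal i j; petal i k] else [set hub; petal i k].
have eF k : e k \in F.
  rewrite /e; case: ifP => [/andP [] //|H].
  apply: contraNT nc => nF.
  have kh : remove_edges F (petal i k) hub.
    by rewrite /remove_edges /= setUC nF.
  have [<-|ne] := eqVneq k j; first exact: connect1.
  apply: connect_trans (connect1 kh); apply: connect1.
  by move: H; rewrite ne /= /remove_edges /= eqxx eq_sym ne /= => ->.
have e_inj : injective e.
  move=> k l; rewrite /e.
  by case: ifP => [/andP [_ _]|_]; case: ifP => [/andP [_ _]|_];
    case/set2_eqP=> -[]; rewrite /petal /hub; congruence.
rewrite -[t.+1]card_ord -(card_imset _ e_inj).
by apply: subset_leq_card; apply/subsetP => _ /imsetP [k _ ->].
Qed.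

Lemma flower_cut_lower (F : {set {set flower}}) :
  disconnecting F -> t.+1 <= #|F|.
Proof.
case=> _ [x [y /negP nc]]; rewrite ltnNge; apply/negP => cF; apply: nc.
have toh z : connect (remove_edges F) z hub.
  by case: z => [[i j]|]; [apply: petal_connect_hub|apply: connect0].
apply: connect_trans (toh x) _.
by rewrite (sym_connect_sym (@remove_edges_sym F)).
Qed.

(** Removing the [t.+1] edges at a clique vertex off the rim isolates it. *)
Lemma flower_cut_upper : 0 < g -> 0 < t ->
  exists2 F : {set {set flower}}, disconnecting F & #|F| = t.+1.
Proof.
move=> g0 t0; pose i := Ordinal g0; pose j : 'I_t.+1 := ord_max.
have j0 : j != ord0 by rewrite -val_eqE /= -lt0n.
(* [nb] enumerates the neighbours of [petal i j]; the index [j], otherwise idle, stands for the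
   hub. *)
pose nb k : flower := if k == j then hub else petal i k.
have nb_neq k : nb k != petal i j.
  by rewrite /nb; case: (eqVneq k j) => // /eqP ne; apply/eqP => -[].
have nb_inj : injective nb.
  move=> k l; rewrite /nb.
  by case: eqP => [->|_]; case: eqP => [->|_] // [].
pose e k : {set flower} := [set petal i j; nb k].
have e_inj : injective e.
  move=> k l /set2_eqP [[_ /nb_inj //]|[E _]].
  by move: (nb_neq l); rewrite E eqxx.
exists (e @: setT); last by rewrite card_imset // cardsT card_ord.
split.
  apply/subsetP => _ /imsetP [k _ ->]; apply/imset2P.
  exists (petal i j) (nb k) => //; rewrite inE /= /nb.
  by case: (eqVneq k j) => //= ne; rewrite eq_sym ne.
exists (petal i j), hub; apply/negP => /connectP [[|z p] //=].
case/andP=> /andP [az /negP nz] _ _; apply: nz.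
case: z az => [[k l]|] /=; last first.
  by move=> _; apply/imsetP; exists j => //; rewrite /e /nb eqxx.
rewrite (negbTE j0) orbF => /andP [/eqP <- ne].
by apply/imsetP; exists l => //; rewrite /e /nb eq_sym (negbTE ne).
Qed.

(** * The rim edges as a guarding set *)

Definition rim_edge (i : 'I_g) : {set flower} :=
  [set petal i ord0; petal (ordS i) ord0].

Lemma ordS_neq (i : 'I_g) : 1 < g -> ordS i != i.
Proof.
move=> g1; rewrite -(inj_eq (@ord_inj _)) val_ordS; have := ltn_ord i.
by case: (i.+1 =P g) => ? ?; lia.
Qed.

(** For [g > 2] the cyclic successor has no 2-cycle. *)
Lemma rim_edge_inj : 2 < g -> injective rim_edge.
Proof.
move=> g2 i k /set2_eqP [[[] //]|[[Ei] [Ek]]].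
have := congr1 (@nat_of_ord g) Ei; have := congr1 (@nat_of_ord g) Ek.
rewrite !val_ordS.
have := ltn_ord i; have := ltn_ord k.
by case: (i.+1 =P g) => ?; case: (k.+1 =P g) => ? ? ? ? ?; apply: ord_inj; lia.
Qed.

Lemma rim_edge_of_cyclic_adj i k : cyclic_adj i k ->
  [set petal i ord0; petal k ord0] \in rim_edge @: setT.
Proof.
case/andP=> _ /orP [] /eqP <-; apply/imsetP.
  by exists i.
by exists k => //; rewrite /rim_edge setUC.
Qed.

Section Guard.
Variable o : rel flower.
Hypothesis ao : acyclic_orientation o.

Let c i : flower := petal i ord0.

(* The escape routes from inside a clique are [c i], which acyclicity forbids,
   and the hub, which cannot lie between equally coloured vertices. *)
Lemma petal_not_below_rim i k l :
  connect o (c i) hub = connect o (c k) hub ->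
  l != ord0 -> connect o (c i) (petal i l) -> ~~ connect o (petal i l) (c k).
Proof.
move=> bik l0 cil; apply/negP => /connectP [p].
elim: p l l0 cil => [|z p IH] l l0 cil /=.
  by move=> _ [_ E]; rewrite E eqxx in l0.
case/andP=> olz pp Ek.
have caz := connect_trans cil (connect1 olz).
have czk : connect o z (c k) by apply/connectP; exists p.
have alz := ao.1.1 _ _ olz.
case: z olz alz pp Ek caz czk => [[m l']|] olz alz pp Ek caz czk; last first.
  have ckh : connect o (c k) hub by rewrite -bik.
  by have := acyclic_connect_anti ao.2 ckh czk.
move: alz; rewrite /= (negbTE l0) orbF => /andP [/eqP Em _]; subst m.
have [E|l'0] := eqVneq l' ord0; last exact: IH l' l'0 caz pp Ek.
by move: olz; rewrite E => /(acyclic_no_return ao.2); rewrite cil.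
Qed.

Lemma flippable_rim_edge : odd g -> 1 < g ->
  exists2 f, f \in rim_edge @: setT & flippable o f.
Proof.
move=> og g1.
pose mono (q : 'I_g * 'I_g) := [&& cyclic_adj q.1 q.2, o (c q.1) (c q.2)
  & connect o (c q.1) hub == connect o (c q.2) hub].
have [q0 mq0] : exists q, mono q.
  have [i Ei] := odd_cycle_monochromatic (fun i => connect o (c i) hub) og.
  have ai : cyclic_adj i (ordS i).
    by rewrite /cyclic_adj eqxx eq_sym ordS_neq.
  have : adj (c i) (c (ordS i)) by rewrite /= ai !orbT.
  move/ao.1.2; have [E _|_ /= oi] := boolP (o (c i) (c (ordS i))).
    by exists (i, ordS i); rewrite /mono /= ai E Ei eqxx.
  by exists (ordS i, i); rewrite /mono /= cyclic_adjC ai oi Ei eqxx.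
(* How low the head lies is measured by the number of vertices that reach it. *)
case: (arg_minnP (fun q => #|[set z | connect o z (c q.2)]|) mq0).
move=> [i k] /and3P [/= aik oik /eqP bik] min.
exists [set c i; c k]; first exact: rim_edge_of_cyclic_adj.
apply: flippable_of_no_detour => // z oiz zk; apply/negP => czk.
have := ao.1.1 _ _ oiz.
case: z oiz zk czk => [[m l]|] oiz zk czk /=; last first.
  have ckh : connect o (c k) hub by rewrite -bik connect1.
  by have := acyclic_connect_anti ao.2 ckh czk.
case/orP=> [/andP [/eqP Em l0]|/andP [/eqP El aim]].
  subst m; rewrite eq_sym in l0.
  by case/negP: (petal_not_below_rim bik l0 (connect1 oiz)).
subst l.
(* [c m] lies between [c i] and [c k], which share a colour, so it has that colour too. *)
have mm : mono (i, m).
  apply/and3P; split=> //=; apply/eqP; apply/idP/idP => H.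
    by rewrite bik in H; apply: connect_trans czk H.
  exact: connect_trans (connect1 oiz) H.
have := min _ mm; rewrite leqNgt => /negP; apply; apply: proper_card => /=.
apply/properP; split.
  by apply/subsetP => w; rewrite !inE => cw; apply: connect_trans cw czk.
exists (c k); rewrite inE ?connect0 //.
apply/negP => ckm; case/eqP: zk.
exact: acyclic_connect_anti ao.2 czk ckm.
Qed.

End Guard.

Lemma guarding_rim : odd g -> 1 < g -> guarding_set (rim_edge @: setT).
Proof.
move=> og g1; split; last by move=> o ao; apply: flippable_rim_edge.
apply/subsetP => _ /imsetP [i _ ->]; apply/imset2P.
exists (petal i ord0) (petal (ordS i) ord0) => //; rewrite inE /=.
by rewrite /cyclic_adj !eqxx eq_sym ordS_neq ?orbT.
Qed.

End CliqueFlower.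

Theorem theorem6 (t g : nat) (ht : 2 <= t) (g_odd : odd g) (hg : 3 <= g <= t) :
  exists G : sgraph, has_edge_connectivity G t /\
    exists S : {set {set G}}, guarding_set S /\ #|S| = g.
Proof.
(* The cliques of [flower g t] have [t.+2] vertices, so its parameter is one less than the
   connectivity. *)
case: t ht hg => [|t] // t1 /andP [g3 _].
exists (flower g t); split.
  by split; [apply: flower_cut_upper => //; lia|apply: flower_cut_lower].
exists (@rim_edge g t @: setT); split; first by apply: guarding_rim; lia.
by rewrite card_imset ?cardsT ?card_ord //; apply: rim_edge_inj.
Qed.
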